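(* Let $p>0$ and let $\mathcal{S}_p=\{x^{-p}e^{ix} : 1<x<\infty\}\subset\mathbb{C}$. Let $0<\alpha\leq 1\leq\beta<\infty$. If $f:(0,1)\to\mathcal{S}_p$ is an $(\alpha,\beta)$-Hölder homeomorphism (onto $\mathcal{S}_p$), then $$\beta\geq\max\left\{\frac{p\alpha}{1+p-2\alpha},\,1\right\}.$$
   Context: For $X,Y\subset\mathbb{C}$ and $0<\alpha\leq1\leq\beta<\infty$, a homeomorphism $f:X\to Y$ is $(\alpha,\beta)$-Hölder if there is a constant $C>0$ such that $C^{-1}|x-y|^\beta\leq|f(x)-f(y)|\leq C|x-y|^\alpha$ for all $x,y\in X$. (Under the hypotheses one always has $1+p-2\alpha>0$.) *)

(* Defs.v *)
From HB Require Import structures.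
From mathcomp Require Import all_boot all_order all_algebra.
From mathcomp Require Import complex.
From mathcomp Require Import all_classical all_reals all_analysis.

Set Implicit Arguments.
Unset Strict Implicit.
Unset Printing Implicit Defensive.

Import Order.TTheory GRing.Theory Num.Theory.
Import numFieldNormedType.Exports.

Local Open Scope classical_set_scope.
Local Open Scope ring_scope.
Local Open Scope complex_scope.

(* The library gives the norm topology to an abstract numFieldType only. *)
HB.instance Definition _ (R : realType) := NormedModule.copy R[i] R[i]^o.

(* Maps between subsets X and Y are represented by total functions, of which
   only the values on X (resp. Y, for the inverse g) matter. *)
Definition homeomorphism {S T : topologicalType} (X : set S) (Y : set T)
    (f : S -> T) : Prop :=
  [/\ set_bij X Y f,
      {within X, continuous f}
    & exists g : T -> S,
        (forall x, X x -> g (f x) = x) /\ {within Y, continuous g}].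

(* [Normc.normc] is the real-valued modulus; [`|z|] has values in [R[i]]. *)
Definition holder_homeomorphism {R : realType} (a b : R) (X Y : set R[i])
    (f : R[i] -> R[i]) : Prop :=
  homeomorphism X Y f /\
  exists2 C : R, 0 < C &
    forall x y, X x -> X y ->
      C^-1 * Normc.normc (x - y) `^ b <= Normc.normc (f x - f y)
        <= C * Normc.normc (x - y) `^ a.

(* e^{it} for real t *)
Definition expi {R : realType} (t : R) : R[i] := cos t +i* sin t.

Definition spiral {R : realType} (p : R) : set R[i] :=
  [set (x `^ (- p))%:C * expi x | x in `]1, +oo[].

(* The real interval (0, 1) as a subset of the complex plane. *)
Definition unit_interval {R : realType} : set R[i] :=
  [set x%:C | x in `]0, 1[].

(* Main.v *)
Require Import Defs.
From HB Require Import structures.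
From mathcomp Require Import all_boot all_order all_algebra.
From mathcomp Require Import complex ring lra.
From mathcomp Require Import all_classical all_reals all_analysis.

Set Implicit Arguments.
Unset Strict Implicit.
Unset Printing Implicit Defensive.

Import Order.TTheory GRing.Theory Num.Theory.
Import numFieldNormedType.Exports.

Local Open Scope ring_scope.

(** Parametrize the spiral by gamma x = x^{-p} e^{ix} and let psi = f^{-1} o gamma,
    which is continuous and injective, hence strictly monotone.  Between the
    points gamma (pi i) and gamma (pi (i + 1)), with k <= i < 2k, the spiral makes
    a half turn of diameter of order k^{-p}, so psi moves by at least a multiple
    of k^{-p/alpha}; by monotonicity these k increments add up, so psi moves by at
    least a multiple of k^{1 - p/alpha} in total.  But the two extreme points are
    at distance O(k^{-p}), so this total is O(k^{-p/beta}).  Letting k grow gives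
    p alpha <= beta (p - alpha), and p - alpha <= 1 + p - 2 alpha. *)

(** If [e] were positive, the first integer above [M ^ (1/e)] would violate the bound. *)
Lemma powR_natr_bounded_le0 (R : realType) (e M : R) :
  (forall k : nat, (0 < k)%N -> k%:R `^ e <= M) -> e <= 0.
Proof.
move=> bnd; rewrite leNgt; apply/negP => e0.
have M0 : 0 <= M by apply: le_trans (bnd 1%N isT); exact: powR_ge0.
have := bnd (Num.truncn (M `^ e^-1)).+1 isT; apply/negP; rewrite -ltNge.
rewrite -[X in X < _](powRr1 M0) -[X in M `^ X](mulVf (lt0r_neq0 e0)) powRrM.
by rewrite gt0_ltr_powR ?nnegrE ?powR_ge0 ?ler0n// truncnS_gt.
Qed.

(** Increments of a monotone sequence share one sign, so their absolute values add without
    cancellation; passing to [- a] reduces to the nondecreasing case. *)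
Lemma monotone_increments_sum (R : realDomainType) (a : nat -> R) (d : R)
    (n : nat) :
  (forall i, a i <= a i.+1) \/ (forall i, a i.+1 <= a i) ->
  (forall i, (i < n)%N -> d <= `|a i.+1 - a i|) ->
  n%:R * d <= `|a n - a 0%N|.
Proof.
wlog a_nondec : a / forall i, a i <= a i.+1.
  move=> wlog_nondec [|a_noninc]; first by move=> ?; apply: wlog_nondec; auto.
  have -> : `|a n - a 0%N| = `|- a n - - a 0%N| by rewrite -opprD normrN.
  move=> incr; apply: (wlog_nondec (fun i => - a i)) => [i||i ltin].
  - by rewrite lerN2.
  - by left=> i; rewrite lerN2.
  - by rewrite -opprD normrN incr.
move=> _ incr; apply: le_trans (ler_norm _).
elim: n incr => [|n IHn] incr; first by rewrite mul0r subrr.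
have {}IHn : n%:R * d <= a n - a 0%N by apply: IHn => i ltin; apply/incr/ltnW.
have := incr n (ltnSn n); rewrite ger0_norm ?subr_ge0// => step.
by rewrite -natr1 mulrDl mul1r; lra.
Qed.

Section Spiral.
Variable R : realType.
Implicit Types p r t x y : R.
Local Open Scope classical_set_scope.

Definition spiral_point p x : R[i] := ((x `^ (- p))%:C * expi x)%C.

Lemma normc_expi r t : Normc.normc (r%:C * expi t)%C = `|r|.
Proof.
rewrite /Normc.normc/expi /= !mul0r subr0 addr0.
by rewrite !exprMn -mulrDr cos2Dsin2 mulr1 sqrtr_sqr.
Qed.

Lemma normc_spiral_point p x : Normc.normc (spiral_point p x) = x `^ (- p).
Proof. by rewrite normc_expi ger0_norm ?powR_ge0. Qed.

Lemma spiral_point_inj p : 0 < p ->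
  {in `]1, +oo[%R &, injective (spiral_point p)}.
Proof.
move=> p0 x y; rewrite !in_itv/= !andbT => x1 y1 /(congr1 (@Normc.normc R)).
rewrite !normc_spiral_point !powRN => /invr_inj.
by apply: powR_injective => //; rewrite nnegrE ltW// (lt_trans ltr01).
Qed.

(** Since [e^{i(x + pi)} = - e^{ix}], the origin lies on the segment between the two points, so
    their moduli add. *)
Lemma normc_spiral_point_half_turn p x :
  Normc.normc (spiral_point p (x + pi) - spiral_point p x) =
  (x + pi) `^ (- p) + x `^ (- p).
Proof.
have -> : spiral_point p (x + pi) - spiral_point p x =
    (((- ((x + pi) `^ (- p) + x `^ (- p)))%:C * expi x)%C : R[i]).
  rewrite /spiral_point /expi cosDpi sinDpi.
  by apply/eqP; rewrite eq_complex /=; apply/andP; split; apply/eqP; ring.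
by rewrite normc_expi normrN ger0_norm// addr_ge0 ?powR_ge0.
Qed.

Lemma normc_le_Re_Im (z : R[i]) :
  Normc.normc z <= `|complex.Re z| + `|complex.Im z|.
Proof.
case: z => a b /=; rewrite -[leRHS]ger0_norm ?addr_ge0// -sqrtr_sqr.
rewrite ler_wsqrtr// sqrrD !real_normK ?num_real//.
by have : 0 <= `|a| * `|b| by []; lra.
Qed.

Lemma spiral_point_near p x (e : R) : 0 < x -> 0 < e ->
  \forall y \near x, Normc.normc (spiral_point p x - spiral_point p y) < e.
Proof.
move=> x0 e0.
have powc : {for x, continuous (fun y => y `^ (- p))}.
  apply/differentiable_continuous/derivable1_diffP/derivable_powR.
  by rewrite in_itv/= andbT.
have e20 : 0 < e / 2 by rewrite divr_gt0.
have /cvgrPdist_lt/(_ _ e20) Rec :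
    y `^ (- p) * cos y @[y --> x] --> x `^ (- p) * cos x.
  exact: (cvgM powc (@continuous_cos R x)).
have /cvgrPdist_lt/(_ _ e20) Imc :
    y `^ (- p) * sin y @[y --> x] --> x `^ (- p) * sin x.
  exact: (cvgM powc (@continuous_sin R x)).
near=> y.
apply: le_lt_trans (normc_le_Re_Im _) _.
rewrite [ltRHS](splitr e) ltrD//= !mul0r ?subr0 ?addr0.
  by near: y; exact: Rec.
by near: y; exact: Imc.
Unshelve. all: by end_near. Qed.

(** Surjectivity of [f] lets [psi x] be chosen in (0, 1) with image [spiral_point p x]; the Hölder
    bounds then carry over. For [x <= 1] the value of [psi] is a dummy. *)
Lemma holder_preimage p (alpha beta : R) (f : R[i] -> R[i]) :
  holder_homeomorphism alpha beta unit_interval (spiral p) f ->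
  exists C : R, exists psi : R -> R, 0 < C /\
    forall x y, 1 < x -> 1 < y ->
      C^-1 * `|psi x - psi y| `^ beta
        <= Normc.normc (spiral_point p x - spiral_point p y)
        <= C * `|psi x - psi y| `^ alpha.
Proof.
move=> [[[_ _ fsurj] _ _] [C C0 fC]].
have /choice[psi psiP] : forall x, exists t,
    1 < x -> unit_interval (t%:C)%C /\ f (t%:C)%C = spiral_point p x.
  move=> x; have [x1|] := ltP 1 x; last by exists 0.
  have [|_ [t t01 <-] ft] := fsurj (spiral_point p x).
    by exists x => //=; rewrite in_itv/= x1.
  by exists t; split => //; exists t.
exists C, psi; split=> // x y x1 y1.
have [Ix <-] := psiP x x1; have [Iy <-] := psiP y y1.
suff -> : `|psi x - psi y| = Normc.normc ((psi x)%:C - (psi y)%:C)%C.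
  exact: fC.
by rewrite /= oppr0 addr0 expr0n/= addr0 sqrtr_sqr.
Qed.

(** The lower bound forces continuity: a jump of [psi] by [e] would keep the spiral points
    [C^-1 * e ^ beta] apart, against continuity of the spiral. A continuous injection of an interval
    is strictly monotone. *)
Lemma preimage_strictly_monotone p (C beta : R) (psi : R -> R) :
  0 < p -> 0 < C -> 0 < beta ->
  (forall x y, 1 < x -> 1 < y -> C^-1 * `|psi x - psi y| `^ beta
     <= Normc.normc (spiral_point p x - spiral_point p y)) ->
  {in `]1, +oo[%R &, injective psi} ->
  {in `]1, +oo[%R &, {homo psi : x y / x < y}} \/
  {in `]1, +oo[%R &, {homo psi : x y /~ x < y}}.
Proof.
move=> p0 C0 beta0 psiC psi_inj; apply: itv_continuous_inj_mono => //.
apply: continuous_in_subspaceT => x; rewrite inE/= in_itv/= andbT => x1.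
apply/cvgrPdist_lt => e e0; have x0 : 0 < x by apply: lt_trans x1.
have d0 : 0 < C^-1 * e `^ beta by rewrite mulr_gt0 ?invr_gt0 ?powR_gt0.
near=> y; have y1 : 1 < y by near: y; exact: lt_nbhsr.
rewrite ltNge; apply/negP => le_e.
have : Normc.normc (spiral_point p x - spiral_point p y) < C^-1 * e `^ beta.
  by near: y; exact: spiral_point_near.
apply/negP; rewrite -leNgt; apply: le_trans (psiC _ _ x1 y1).
by rewrite ler_pM2l ?invr_gt0// ge0_ler_powR ?nnegrE// ltW.
Unshelve. all: by end_near. Qed.

End Spiral.

(** The left side of the conclusion is the exponent of [k] left over when the lower and upper bounds
    for the total variation of [psi] are compared. *)
Lemma spiral_exponents (R : realType) (p alpha beta C : R) (psi : R -> R) :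
  0 < p -> 0 < alpha -> 0 < beta -> 0 < C ->
  (forall x y, 1 < x -> 1 < y ->
     C^-1 * `|psi x - psi y| `^ beta
       <= Normc.normc (spiral_point p x - spiral_point p y)
       <= C * `|psi x - psi y| `^ alpha) ->
  alpha * beta + p * alpha - p * beta <= 0.
Proof.
move=> p0 alpha0 beta0 C0 psiC.
have psi_inj : {in `]1, +oo[%R &, injective psi}.
  move=> x y xI yI psixy; apply: (spiral_point_inj p0 xI yI).
  move: xI yI; rewrite !in_itv/= !andbT => x1 y1.
  have /andP[_] := psiC x y x1 y1.
  (* As [alpha > 0], the upper bound collapses to [C * 0 ^ alpha = 0], so the two spiral points
     coincide. *)
  rewrite psixy subrr normr0 powR0 ?gt_eqF// mulr0 => norm_le0.
  apply/eqP; rewrite -subr_eq0; apply/eqP/Normc.eq0_normc/le_anti.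
  rewrite norm_le0/=; move: (spiral_point p x - spiral_point p y) => [u v].
  exact: sqrtr_ge0.
have psi_mono : {in `]1, +oo[%R &, {homo psi : x y / x < y}} \/
    {in `]1, +oo[%R &, {homo psi : x y /~ x < y}}.
  apply: (@preimage_strictly_monotone _ p C beta) => // x y x1 y1.
  by have /andP[] := psiC x y x1 y1.
have pi0 := @pi_gt0 R.
(* For [i < k] the half turn from [x i] has length at least [(x i) ^ (- p) >= (2 pi k) ^ (- p)],
   whence [c1]. Both extreme points have modulus at most [(pi k) ^ (- p)], whence the factor 2 in
   [c2]. *)
pose c1 := C^-1 * (2 * pi) `^ (- p); pose c2 := 2 * C * pi `^ (- p).
have c10 : 0 < c1 by rewrite mulr_gt0 ?invr_gt0 ?powR_gt0 ?mulr_gt0.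
have c20 : 0 < c2 by rewrite !mulr_gt0 ?powR_gt0.
apply: (@powR_natr_bounded_le0 _ _ (c2 `^ alpha / c1 `^ beta)) => k k0.
have K0 : 0 < k%:R :> R by rewrite ltr0n.
pose x i : R := pi * (k + i)%:R.
have x_gt1 i : 1 < x i.
  apply: (@lt_le_trans _ _ 2); first by rewrite ltr1n.
  by rewrite -[2]mulr1 ler_pM ?pi_ge2 ?ler1n ?addn_gt0 ?k0.
have x0 i : 0 < x i by apply: lt_trans (x_gt1 i).
have xS i : x i.+1 = x i + pi by rewrite /x addnS -natr1 mulrDr mulr1.
have xltS i : x i < x i.+1 by rewrite xS ltrDl.
have a_mono : (forall i, psi (x i) <= psi (x i.+1)) \/
              (forall i, psi (x i.+1) <= psi (x i)).
  by case: psi_mono => mono; [left|right] => i;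
    apply/ltW/mono; rewrite ?in_itv/= ?andbT.
have Npow_le y z : 0 < y -> y <= z -> z `^ (- p) <= y `^ (- p).
  move=> y0 yz; have z0 : 0 < z by apply: lt_le_trans yz.
  by rewrite !powRN lef_pV2 ?posrE ?powR_gt0// ge0_ler_powR ?nnegrE// ltW.
have incr i : (i < k)%N ->
    (c1 * k%:R `^ (- p)) `^ alpha^-1 <= `|psi (x i.+1) - psi (x i)|.
  move=> ltik; set z := leRHS.
  have -> : z = z `^ alpha `^ alpha^-1.
    by rewrite -powRrM mulfV ?gt_eqF// powRr1 ?normr_ge0.
  rewrite ge0_ler_powR ?nnegrE ?invr_ge0 ?powR_ge0 ?(ltW alpha0)//.
    by rewrite mulr_ge0 ?powR_ge0// ltW.
  have /andP[_] := psiC _ _ (x_gt1 i.+1) (x_gt1 i).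
  rewrite [in spiral_point _ _]xS normc_spiral_point_half_turn -ler_pdivrMl//; apply: le_trans.
  rewrite /c1 -mulrA ler_pM2l ?invr_gt0//.
  rewrite -powRM ?mulr_ge0 ?(ltW pi0) ?(ltW K0)//.
  apply: ler_wpDl; first exact: powR_ge0.
  apply: Npow_le => //; rewrite /x -mulrA mulrCA ler_pM2l//.
  by rewrite -natrM ler_nat mul2n -addnn leq_add2l ltnW.
have := @monotone_increments_sum _ (psi \o x) _ k a_mono incr.
set D := `|_ - _|; set d := _ `^ alpha^-1 => sum_le.
have d0 : 0 <= d by exact: powR_ge0.
have Dbeta : D `^ beta <= c2 * k%:R `^ (- p).
  have /andP[] := psiC _ _ (x_gt1 k) (x_gt1 0%N).
  rewrite ler_pdivrMl// => le_norm _; apply: (le_trans le_norm).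
  rewrite /c2 -mulrA -powRM ?(ltW pi0) ?(ltW K0)// [2 * C]mulrC -mulrA.
  rewrite ler_pM2l//; apply: (le_trans (le_normcD _ _)).
  rewrite normcN !normc_spiral_point mulr2n mulrDl mul1r.
  by rewrite /x addn0 lerD2r Npow_le ?mulr_gt0// ler_pM2l// ler_nat leq_addr.
(* The extra power [alpha] clears the root [1 / alpha] in [d]. *)
have : (k%:R * d) `^ beta `^ alpha <= (c2 * k%:R `^ (- p)) `^ alpha.
  rewrite ge0_ler_powR ?nnegrE ?powR_ge0 ?(ltW alpha0)//.
    by rewrite mulr_ge0 ?powR_ge0// ltW.
  apply: le_trans Dbeta; rewrite ge0_ler_powR ?nnegrE ?(ltW beta0)//.
  - by rewrite mulr_ge0// ltW.
  - exact: normr_ge0.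
clearbody c1 c2.
rewrite powRAC (@powRM _ _ d)// ?(ltW K0)// /d -[in X in _ * X]powRrM mulVf ?gt_eqF//.
rewrite powRr1 ?mulr_ge0 ?powR_ge0 ?(ltW c10)//.
rewrite !powRM ?powR_ge0 ?mulr_ge0 ?powR_ge0 ?(ltW c10) ?(ltW c20)//.
rewrite -!powRrM => final.
rewrite !powRD ?(lt0r_neq0 K0) ?implybT//.
rewrite ler_pdivlMr ?powR_gt0//.
rewrite !mulNr [k%:R `^ (- (p * alpha))]powRN in final.
have Kpa : 0 < k%:R `^ (p * alpha) by rewrite powR_gt0.
rewrite -(ler_pM2r Kpa) -[leRHS]mulrA mulVf ?gt_eqF// mulr1 in final.
by apply: le_trans final; rewrite le_eqVlt; apply/orP/or_introl/eqP; ring.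
Qed.

Theorem corollary4p7 (R : realType) (p alpha beta : R) (f : R[i] -> R[i])
    (hp : 0 < p) (halpha0 : 0 < alpha) (halpha1 : alpha <= 1)
    (hbeta : 1 <= beta)
    (hf : holder_homeomorphism alpha beta unit_interval (spiral p) f) :
  Num.max (p * alpha / (1 + p - 2 * alpha)) 1 <= beta.
Proof.
have beta0 : 0 < beta by apply: lt_le_trans hbeta.
have [C [psi [C0 psiC]]] := holder_preimage hf.
have exps := spiral_exponents hp halpha0 beta0 C0 psiC.
rewrite ge_max hbeta andbT.
(* A nonpositive denominator makes the quotient nonpositive, including the value 0 of division by
   zero. *)
have [den0|den0] := ltP 0 (1 + p - 2 * alpha); last first.
  by rewrite (le_trans _ (ltW beta0))// mulr_ge0_le0 ?invr_le0// mulr_ge0 ?ltW.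
(* What is left beyond [exps] is [beta * (1 - alpha) >= 0]. *)
by rewrite ler_pdivrMr//; nra.
Qed.
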